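(* Let $k'$ be such that $$(\ast)\quad u_k=1\quad\forall k\in\{2,\dots,K\},\ k\le k'$$ are valid equalities for both (APC2) and (APC2-Ry). Let $(y^*,u^* )$ be an optimal solution of (APC2-R) with the constraints $(\ast)$ added. If $u^*$ is binary, let $k^*$ be the largest $k$ such that $u^*_k=1$ (with $k^*=1$ if there is no such $k$). If $u^*$ is not binary, let $k^*$ be the smallest $k$ such that $u^*_k<1$, i.e., $u^*_{k^*}$ is the first fractional entry of $u^*$. Then the constraints $$u_k=1\quad\forall k\in\{2,\dots,K\},\ k\le k^*$$ are valid equalities for both (APC2) and (APC2-Ry), i.e., when adding them to (APC2) and (APC2-Ry), the respective sets of feasible solutions do not change.
   Context: Given are a finite set of points $N$, a positive integer $p<|N|$, a positive integer $\alpha\le p$, and distances $d_{ij}\ge 0$ for $i,j\in N$ (an instance of the discrete $\alpha$-neighbor $p$-center problem). Let $D=\{d_{ij}: i,j\in N, i\ne j\}=\{d_1,\dots,d_K\}$ with $d_1<d_2<\dots<d_K$, and for $i\in N$ let $D_i=\{d_{ij}: j\in N\setminus\{i\}\}\setminus\{d_1\}$. Formulation (APC2), in variables $u_k$ ($k=2,\dots,K$) and $y_j$ ($j\in N$): minimize $d_1+\sum_{k=2}^K(d_k-d_{k-1})u_k$ subject to - $\sum_{j\in N}y_j=p$; - $u_{k-1}\ge u_k$ for all $k\in\{3,\dots,K\}$; - $\alpha u_k+\sum_{j\in N\setminus\{i\}: d_{ij}<d_k} y_j\ge \alpha(1-y_i)$ for all $i\in N$ and all $d_k\in D_i$; - $u_k\in\{0,1\}$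 for all $k\in\{2,\dots,K\}$; $y_j\in\{0,1\}$ for all $j\in N$. (APC2-Ry) is (APC2) with $y_j\in\{0,1\}$ replaced by $0\le y_j\le1$ for all $j\in N$ (the $u$-variables remain binary). (APC2-R) is the linear relaxation of (APC2): $u_k\in\{0,1\}$ replaced by $0\le u_k\le 1$ and $y_j\in\{0,1\}$ replaced by $0\le y_j\le1$. Equalities are called valid for a formulation if adding them does not change its set of feasible solutions. *)

(* Defs.v *)
From HB Require Import structures.
From mathcomp Require Import all_boot all_order all_algebra.

Set Implicit Arguments.
Unset Strict Implicit.
Unset Printing Implicit Defensive.

Import Order.TTheory GRing.Theory Num.Theory.
Local Open Scope ring_scope.

(* Mixed-integer formulations of the discrete alpha-neighbor p-center problem
   and their relaxations.  Only the off-diagonal values of d are used; neither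
   symmetry nor the triangle inequality is assumed.  A formulation is identified
   with its set of feasible solutions (y, u); the objective is common to all. *)

Section Instance.

Variables (R : realFieldType) (N : finType) (d : N -> N -> R).

(* The set D, listed without repetition in increasing order. *)
Definition distances : seq R :=
  sort <=%R (undup [seq d ij.1 ij.2 | ij <- enum {: N * N} & ij.1 != ij.2]).

Definition nbdist : nat := size distances.

(* d_k, for k = 1, ..., K (1-based, as in d_1 < ... < d_K). *)
Definition dist (k : nat) : R := nth 0 distances k.-1.

Definition distances_from (i : N) : pred R :=
  [pred r | [exists j, (j != i) && (r == d i j)] && (r != dist 1)].

(* The index set {2, ..., K} of the u-variables. *)
Definition level := {k : 'I_nbdist.+1 | (1 < k)%N}.
HB.instance Definition _ := Finite.on level.
Definition nat_of_level (k : level) : nat := val (val k).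
Coercion nat_of_level : level >-> nat.

Definition formulation := {ffun N -> R} -> {ffun level -> R} -> Prop.

Definition objective (u : {ffun level -> R}) : R :=
  dist 1 + \sum_(k : level) (dist k - dist k.-1) * u k.

Definition linear_constraints (p alpha : nat) : formulation := fun y u =>
  [/\ \sum_j y j = p%:R,
      forall l k : level, (l.+1 = k)%N -> u k <= u l
    & forall (i : N) (k : level), dist k \in distances_from i ->
        alpha%:R * (1 - y i) <=
          alpha%:R * u k + \sum_(j | (j != i) && (d i j < dist k)) y j].

Definition binary (I : finType) (x : {ffun I -> R}) : Prop :=
  forall i, x i = 0 \/ x i = 1.

Definition unit_box (I : finType) (x : {ffun I -> R}) : Prop :=
  forall i, 0 <= x i <= 1.

Definition APC2 (p alpha : nat) : formulation := fun y u =>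
  [/\ linear_constraints p alpha y u, binary u & binary y].

Definition APC2_Ry (p alpha : nat) : formulation := fun y u =>
  [/\ linear_constraints p alpha y u, binary u & unit_box y].

Definition APC2_R (p alpha : nat) : formulation := fun y u =>
  [/\ linear_constraints p alpha y u, unit_box u & unit_box y].

Definition add_constraints (F E : formulation) : formulation :=
  fun y u => F y u /\ E y u.

Definition valid (E F : formulation) : Prop :=
  forall y u, add_constraints F E y u <-> F y u.

Definition optimal (F : formulation) : formulation := fun y u =>
  F y u /\ forall y' u', F y' u' -> objective u <= objective u'.

Definition ones_upto (k0 : nat) : formulation := fun _ u =>
  forall k : level, (k <= k0)%N -> u k = 1.

(* With the convention m = 1 when no entry of u equals 1. *)
Definition largest_one (u : {ffun level -> R}) (m : nat) : Prop :=
  (exists k : level, [/\ k = m :> nat, u k = 1 &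
     forall l : level, u l = 1 -> (l <= m)%N])
  \/ ((forall k : level, u k <> 1) /\ m = 1%N).

Definition first_below_one (u : {ffun level -> R}) (m : nat) : Prop :=
  exists k : level, [/\ k = m :> nat, u k < 1 &
    forall l : level, u l < 1 -> (m <= l)%N].

Definition is_kstar (u : {ffun level -> R}) (m : nat) : Prop :=
  (binary u -> largest_one u m) /\ (~ binary u -> first_below_one u m).

End Instance.

(* Main.v *)
Require Import Defs.
From mathcomp Require Import all_boot all_order all_algebra.

Set Implicit Arguments.
Unset Strict Implicit.

Import Order.TTheory GRing.Theory Num.Theory.
Local Open Scope ring_scope.

(** Because the distances are strictly increasing, the objective is, up to the
    constant [dist d 1], a positive combination of the entries of [u], so it is
    strictly monotone for the pointwise order ([objective_inj_le]).  Every
    feasible [(y, u)] of (APC2-Ry) has a binary, nonincreasing [u], that is, a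
    run of ones followed by zeros, and, since the equalities up to [k'] are
    valid, it also competes with [(ystar, ustar)] in the relaxation.  If the run
    of ones stopped before [kstar], then [u] would lie pointwise below [ustar]:
    [ustar] is 1 before [kstar], and [u] is 0 from some level not beyond [kstar]
    on.  Optimality of [ustar] then forces [u = ustar].  This is absurd: if
    [ustar] is binary, then [ustar] is 1 on all levels up to [kstar], where [u]
    already has a zero; if [ustar] is not binary, it differs from the binary
    [u].  Finally, validity for (APC2-Ry) passes to the smaller feasible set of
    (APC2). *)

Lemma dist_pred_lt (R : realFieldType) (N : finType) (d : N -> N -> R)
    (k : level d) : dist d k.-1 < dist d k.
Proof.
have k_gt1 : (1 < k)%N := valP k.
have k_le : (k <= nbdist d)%N by rewrite -ltnS; exact: (ltn_ord (val k)).
have s_lt : sorted <%R (distances d) by rewrite sort_lt_sorted undup_uniq.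
case: (nat_of_level k) k_gt1 k_le => [|[|m]] // _ m_lt.
by rewrite /dist (lt_sorted_ltn_nth 0 s_lt) ?inE //= ltnW.
Qed.

(** This is strict monotonicity, in the form in which optimality uses it. *)
Lemma objective_inj_le (R : realFieldType) (N : finType) (d : N -> N -> R)
    (u v : {ffun level d -> R}) :
  (forall k : level d, u k <= v k) -> objective v <= objective u -> u = v.
Proof.
move=> le_uv; rewrite lerD2l => le_vu.
have term_le (k : level d) : true -> (dist d k - dist d k.-1) * u k <=
                         (dist d k - dist d k.-1) * v k.
  by move=> _; rewrite ler_pM2l ?subr_gt0 ?dist_pred_lt.
have term_ge0 (k : level d) : true -> 0 <= (dist d k - dist d k.-1) * v k -
                              (dist d k - dist d k.-1) * u k.
  by move=> /term_le; rewrite subr_ge0.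
have /(psumr_eq0P term_ge0) gap0 :
    \sum_(k : level d) ((dist d k - dist d k.-1) * v k -
                        (dist d k - dist d k.-1) * u k) = 0.
  by apply/eqP; rewrite sumrB subr_eq0 eq_le le_vu ler_sum.
apply/ffunP => k; have /eqP := gap0 k isT.
rewrite -mulrBr mulf_eq0 gt_eqF ?subr_gt0 ?dist_pred_lt //= subr_eq0.
by move/eqP.
Qed.

Lemma level_antitone (R : realFieldType) (N : finType) (d : N -> N -> R)
    (u : {ffun level d -> R}) :
  (forall l k : level d, (l.+1 = k)%N -> u k <= u l) ->
  forall l k : level d, (l <= k)%N -> u k <= u l.
Proof.
move=> u_step l k; move: {2}(nat_of_level k) (erefl (nat_of_level k)) => n.
elim: n k => [|n IHn] k k_eq; first by have : (1 < k)%N := valP k; rewrite k_eq.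
rewrite leq_eqVlt => /orP[/eqP lk|].
  by rewrite (_ : k = l) //; apply/val_inj/val_inj.
rewrite k_eq ltnS => l_le_n.
have n_lt : (n < (nbdist d).+1)%N.
  by rewrite ltnW // -k_eq; exact: (ltn_ord (val k)).
have n_gt1 : (1 < n)%N := leq_trans (valP l) l_le_n.
pose k1 : level d := exist _ (Ordinal n_lt) n_gt1.
exact: le_trans (u_step k1 k (esym k_eq)) (IHn k1 erefl l_le_n).
Qed.

Lemma binary_dec (R : realFieldType) (I : finType) (x : {ffun I -> R}) :
  binary x \/ ~ binary x.
Proof.
have [/forallP x01|x01] := boolP [forall i, (x i == 0) || (x i == 1)].
  by left=> i; case/orP: (x01 i) => /eqP; [left|right].
right=> x_bin; case/negP: x01; apply/forallP=> i.
by case: (x_bin i) => ->; rewrite eqxx ?orbT.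
Qed.

Lemma binary_unit_box (R : realFieldType) (I : finType) (x : {ffun I -> R}) :
  binary x -> unit_box x.
Proof. by move=> x01 i; case: (x01 i) => ->; rewrite ?lexx ?ler01. Qed.

Lemma APC2_sub_Ry (R : realFieldType) (N : finType) (d : N -> N -> R)
    (p alpha : nat) (y : {ffun N -> R}) (u : {ffun level d -> R}) :
  APC2 p alpha y u -> APC2_Ry p alpha y u.
Proof. by case=> lin u01 y01; split=> //; exact: binary_unit_box. Qed.

Lemma APC2_Ry_sub_R (R : realFieldType) (N : finType) (d : N -> N -> R)
    (p alpha : nat) (y : {ffun N -> R}) (u : {ffun level d -> R}) :
  APC2_Ry p alpha y u -> APC2_R p alpha y u.
Proof. by case=> lin u01 y01; split=> //; exact: binary_unit_box. Qed.

(** The part of the definition of [kstar] that the binary and the fractional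
    case share.  The bound is strict because, in the fractional case, the entry
    at [kstar] itself is below 1. *)
Lemma kstar_ones (R : realFieldType) (N : finType) (d : N -> N -> R)
    (u : {ffun level d -> R}) (m : nat) :
  (forall l k : level d, (l <= k)%N -> u k <= u l) -> unit_box u ->
  is_kstar u m -> forall l : level d, (l < m)%N -> u l = 1.
Proof.
move=> u_anti u_box [m_bin m_frac] l l_lt_m; apply/eqP.
have /andP[_ ul_le1] := u_box l; rewrite eq_le ul_le1 /=.
have [/m_bin [[k [km uk1 _]]|[_ m1]]|/m_frac [k [_ _ k_min]]] := binary_dec u.
- by rewrite -uk1; apply: u_anti; rewrite km ltnW.
- by have : (1 < l)%N := valP l; rewrite ltnNge ltnW // -m1.
- by rewrite leNgt; apply/negP => /k_min; rewrite leqNgt l_lt_m.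
Qed.

(** The binary [u] vanishes from level [k] on, where [v] is nonnegative, and is
    at most 1 before [k], where [v] equals 1. *)
Lemma binary_le_of_zero (R : realFieldType) (N : finType) (d : N -> N -> R)
    (u v : {ffun level d -> R}) (k : level d) :
  (forall l m : level d, (l <= m)%N -> u m <= u l) -> binary u -> unit_box v ->
  u k = 0 -> (forall l : level d, (l < k)%N -> v l = 1) ->
  forall l : level d, u l <= v l.
Proof.
move=> u_anti u01 v_box uk0 v1 l.
have /andP[_ ul_le1] := binary_unit_box u01 l.
have /andP[vl_ge0 _] := v_box l.
have [l_lt_k|k_le_l] := ltnP l k; first by rewrite v1.
by apply: le_trans vl_ge0; rewrite -uk0 u_anti.
Qed.

Lemma APC2_Ry_ones_upto_kstar (R : realFieldType) (N : finType)
    (d : N -> N -> R) (p alpha k' kstar : nat) (ystar : {ffun N -> R})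
    (ustar : {ffun level d -> R}) :
  valid (ones_upto (d := d) k') (APC2_Ry p alpha) ->
  optimal (add_constraints (APC2_R p alpha) (ones_upto k')) ystar ustar ->
  is_kstar ustar kstar ->
  forall (y : {ffun N -> R}) (u : {ffun level d -> R}),
    APC2_Ry p alpha y u -> ones_upto kstar y u.
Proof.
move=> valid_k' [[[[_ us_step _] us_box _] _] us_min] kstarP y u y_u k k_le.
have [[_ u_step _] u01 _] := y_u.
have [_ u_ones] := (valid_k' y u).2 y_u.
have us_anti := level_antitone us_step.
have us1 := kstar_ones us_anti us_box kstarP.
case: (u01 k) => // uk0.
have u_eq : u = ustar.
  apply: objective_inj_le.
    apply: (@binary_le_of_zero _ _ _ _ _ k) => //; first exact: level_antitone.
    by move=> l l_lt; apply: us1; exact: leq_trans k_le.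
  by apply: (us_min y); split=> //; exact: APC2_Ry_sub_R.
have [kstar_bin _] := kstarP.
have us01 : binary ustar by rewrite -u_eq.
case: (kstar_bin us01) => [[m [m_eq um1 _]]|[_ kstar1]]; last first.
  by have : (1 < k)%N := valP k; rewrite ltnNge -kstar1 k_le.
have := us_anti k m; rewrite m_eq um1 -u_eq uk0 => /(_ k_le).
by rewrite ler10.
Qed.

Theorem lemma18 (R : realFieldType) (N : finType) (p alpha : nat)
    (d : N -> N -> R)
    (p_gt0 : (0 < p)%N) (p_lt_N : (p < #|N|)%N)
    (alpha_gt0 : (0 < alpha)%N) (alpha_le_p : (alpha <= p)%N)
    (d_ge0 : forall i j, 0 <= d i j)
    (k' : nat)
    (valid_APC2 : valid (ones_upto (d := d) k') (APC2 p alpha))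
    (valid_APC2_Ry : valid (ones_upto (d := d) k') (APC2_Ry p alpha))
    (ystar : {ffun N -> R}) (ustar : {ffun level d -> R})
    (opt_star : optimal (add_constraints (APC2_R p alpha) (ones_upto k'))
                  ystar ustar)
    (kstar : nat) (kstarP : is_kstar ustar kstar) :
  valid (ones_upto (d := d) kstar) (APC2 p alpha) /\
  valid (ones_upto (d := d) kstar) (APC2_Ry p alpha).
Proof.
have ones := APC2_Ry_ones_upto_kstar
  valid_APC2_Ry opt_star kstarP.
split=> y u; split=> [[]|y_u] //; split=> //; apply: ones => //.
exact: APC2_sub_Ry.
Qed.
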